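(* Let $n\ge 2$, let $(L,[\cdot,\dots,\cdot],\varepsilon,\alpha)$ be an $n$-Hom-Lie color algebra and let $\beta:L\to L$ be an averaging operator of $L$. Fix $1\le i<j\le n$ and define $$\{x_1,\dots,x_n\}=[x_1,\dots,\beta(x_i),\dots,\beta(x_j),\dots,x_n]$$ (with $\beta$ applied to the $i$-th and $j$-th arguments only). Then the new bracket $\{\cdot,\dots,\cdot\}$ makes $L$ into an $n$-Hom-Lie color algebra, i.e. $(L,\{\cdot,\dots,\cdot\},\varepsilon,\alpha)$ is an $n$-Hom-Lie color algebra.
   Context: $G$ is an abelian group with neutral element $e$ (operation written $+$), $\mathbb{K}$ is a field of characteristic different from 2. A $G$-graded linear space is $V=\bigoplus_{a\in G}V_a$ over $\mathbb{K}$; $\mathcal{H}(V)$ is its set of homogeneous elements; a linear map $f:V\to V'$ is even if $f(V_a)\subseteq V'_a$ for all $a$. A (skew-symmetric) bicharacter is a map $\varepsilon:G\times G\to\mathbb{K}^*$ with $\varepsilon(a,b)\varepsilon(b,a)=1$, $\varepsilon(a,b+c)=\varepsilon(a,b)\varepsilon(a,c)$, $\varepsilon(a+b,c)=\varepsilon(a,c)\varepsilon(b,c)$. For homogeneous $x,y$ one writes $\varepsilon(x,y)$ for $\varepsilon(\deg x,\deg y)$, and sums of homogeneous elements inside $\varepsilon$ denote sums of their degrees. An $n$-Hom-Lie color algebra $(L,[\cdot,\dots,\cdot],\varepsilon,\alpha)$ is a $G$-graded linear space $L$ with an $n$-linear map $[\cdot,\dots,\cdot]:L^n\to L$, a bicharacter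 $\varepsilon$ and an even linear map $\alpha:L\to L$ such that for all $x_i,y_j\in\mathcal{H}(L)$: (1) $[x_1,\dots,x_i,x_{i+1},\dots,x_n]=-\varepsilon(x_i,x_{i+1})[x_1,\dots,x_{i+1},x_i,\dots,x_n]$ for $1\le i\le n-1$; (2) $[\alpha(x_1),\dots,\alpha(x_{n-1}),[y_1,\dots,y_n]]=\sum_{i=1}^n\varepsilon(X,Y_i)[\alpha(y_1),\dots,\alpha(y_{i-1}),[x_1,\dots,x_{n-1},y_i],\alpha(y_{i+1}),\dots,\alpha(y_n)]$, where $X=x_1+\dots+x_{n-1}$, $Y_i=y_1+\dots+y_{i-1}$ (sums of degrees, $Y_1=e$). An averaging operator of $L$ is an even linear map $\beta:L\to L$ such that $\beta\alpha=\alpha\beta$ and, for all distinct indices $p\neq q$ in $\{1,\dots,n\}$ and all $x_1,\dots,x_n\in L$, $\beta$ applied to the bracket of $x_1,\dots,x_n$ with $x_p$ replaced by $\beta(x_p)$ equals the bracket of $x_1,\dots,x_n$ with $x_p$ replaced by $\beta(x_p)$ and $x_q$ replaced by $\beta(x_q)$. *)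

(* Defs.v *)
From HB Require Import structures.
From mathcomp Require Import all_boot all_order all_algebra perm.

Set Implicit Arguments.
Unset Strict Implicit.
Unset Printing Implicit Defensive.

Import GRing.Theory.
Local Open Scope ring_scope.

Section Arguments.

Variables (n : nat) (L : Type).

Definition set_arg (x : {ffun 'I_n -> L}) (k : 'I_n) (v : L)
  : {ffun 'I_n -> L} := [ffun l => if l == k then v else x l].

Definition map_args (f : L -> L) (A : {pred 'I_n}) (x : {ffun 'I_n -> L})
  : {ffun 'I_n -> L} := [ffun l => if l \in A then f (x l) else x l].

Definition swap_args (x : {ffun 'I_n -> L}) (k l : 'I_n)
  : {ffun 'I_n -> L} := [ffun m => x (tperm k l m)].

(* (x_1, ..., x_(n-1), z): [insub] fails exactly on the last index. *)
Definition rcons_args (x : {ffun 'I_n.-1 -> L}) (z : L)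
  : {ffun 'I_n -> L} := [ffun l : 'I_n => oapp x z (insub (val l))].

End Arguments.

Section Graded.

Variables (K : fieldType) (G : zmodType) (L : lmodType K).

(* L is the direct sum of the subspaces gr a. *)
Record grading (gr : G -> {pred L}) : Prop := {
  grading_submod : forall a, GRing.submod_closed (gr a);
  grading_span : forall v, exists s : seq G, exists c : G -> L,
    [/\ uniq s, forall a, c a \in gr a & v = \sum_(a <- s) c a];
  grading_indep : forall (s : seq G) (c : G -> L),
    uniq s -> (forall a, c a \in gr a) -> \sum_(a <- s) c a = 0 ->
    forall a, a \in s -> c a = 0
}.

Definition even_map (gr : G -> {pred L}) (f : L -> L) : Prop :=
  forall a v, v \in gr a -> f v \in gr a.

Record bicharacter (eps : G -> G -> K) : Prop := {
  bichar_neq0 : forall a b, eps a b != 0;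
  bichar_skew : forall a b, eps a b * eps b a = 1;
  bicharDr : forall a b c, eps a (b + c) = eps a b * eps a c;
  bicharDl : forall a b c, eps (a + b) c = eps a c * eps b c
}.

Definition multilinear n (br : {ffun 'I_n -> L} -> L) : Prop :=
  forall (x : {ffun 'I_n -> L}) (k : 'I_n),
    linear (fun v => br (set_arg x k v)).

(* Homogeneity of x_k is expressed by a degree a_k with x_k \in gr a_k. The    *)
(* degree is unique unless x_k = 0, in which case both sides of the two        *)
(* identities below vanish, whatever a_k is.                                   *)
Definition color_skew n (gr : G -> {pred L}) (br : {ffun 'I_n -> L} -> L)
    (eps : G -> G -> K) : Prop :=
  forall (a : 'I_n -> G) (x : {ffun 'I_n -> L}),
    (forall k, x k \in gr (a k)) ->
  forall k l : 'I_n, l = k.+1 :> nat ->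
    br x = - (eps (a k) (a l) *: br (swap_args x k l)).

Definition hom_Nambu n (gr : G -> {pred L}) (br : {ffun 'I_n -> L} -> L)
    (eps : G -> G -> K) (alpha : L -> L) : Prop :=
  forall (a : 'I_n.-1 -> G) (x : {ffun 'I_n.-1 -> L})
         (b : 'I_n -> G) (y : {ffun 'I_n -> L}),
    (forall k, x k \in gr (a k)) -> (forall k, y k \in gr (b k)) ->
  br (rcons_args [ffun k => alpha (x k)] (br y)) =
  \sum_(i < n)
    eps (\sum_(k < n.-1) a k) (\sum_(k < n | (k < i)%N) b k) *:
    br (set_arg [ffun k => alpha (y k)] i (br (rcons_args x (y i)))).

Record nHomLieColor n (gr : G -> {pred L}) (br : {ffun 'I_n -> L} -> L)
    (eps : G -> G -> K) (alpha : {linear L -> L}) : Prop := {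
  nHLC_grading : grading gr;
  nHLC_multilinear : multilinear br;
  nHLC_bicharacter : bicharacter eps;
  nHLC_even : even_map gr alpha;
  nHLC_skew : color_skew gr br eps;
  nHLC_Nambu : hom_Nambu gr br eps alpha
}.

Record averaging_operator n (gr : G -> {pred L}) (br : {ffun 'I_n -> L} -> L)
    (alpha beta : {linear L -> L}) : Prop := {
  avg_even : even_map gr beta;
  avg_comm : forall v, beta (alpha v) = alpha (beta v);
  avg_bracket : forall (p q : 'I_n) (x : {ffun 'I_n -> L}), p != q ->
    beta (br (map_args beta (pred1 p) x)) = br (map_args beta (pred2 p q) x)
}.

End Graded.

(* Main.v *)
(* Write {x} for the new bracket, and let p <> q.  Averaging says that the     *)
(* bracket with beta at positions p and q equals beta [x with beta at p]; as   *)
(* this is symmetric in p and q, it does not depend on the pair and is always  *)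
(* {x}.  Moreover inserting one more beta at any position of {x} gives         *)
(* beta {x}.  Skew-symmetry at (k, k+1) follows by taking the pair (k, k+1).   *)
(* For the Nambu identity, taking the first and last positions gives           *)
(*   {alpha x, {y}} = [alpha x', beta {y}] = [alpha x', [y'']],                *)
(* where x' is x with beta at the first position and y'' is y with beta at p   *)
(* and beta^2 at q; in each summand of the old Nambu identity for x', y'' the  *)
(* copies of beta can be moved to where the new identity wants them.           *)
Require Import Defs.
From HB Require Import structures.
From mathcomp Require Import all_boot all_order all_algebra perm.

Set Implicit Arguments.
Unset Strict Implicit.
Unset Printing Implicit Defensive.

Import GRing.Theory.
Local Open Scope ring_scope.

(** Each identity for the new bracket is an instance of the old one at arguments modified by [beta].
    The pair carrying [beta] may be chosen freely ([averaging_pred2]), a further [beta] can be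
    pulled out of the bracket ([averaging_pred2_beta]), and since [beta] is even, the degrees and
    the factors [eps] do not change ([homogeneous_map_args]). [averaging_color_skew] and
    [averaging_hom_Nambu] carry this out. *)

Section Arguments.

Variables (n : nat) (L : Type).
Implicit Types (x : {ffun 'I_n -> L}) (f : L -> L).

Lemma map_set_arg f (A : {pred 'I_n}) x k v :
  map_args f A (set_arg x k v) =
  set_arg (map_args f A x) k (if k \in A then f v else v).
Proof. by apply/ffunP=> l; rewrite !ffunE; case: eqP => // ->. Qed.

Lemma set_arg_map1 f x k v :
  set_arg (map_args f (pred1 k) x) k v = set_arg x k v.
Proof. by apply/ffunP=> l; rewrite !ffunE inE; case: eqP. Qed.

(** The transposition of [k] and [l] preserves the set of positions where [f] acts. *)
Lemma map_swap_args f k l x :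
  map_args f (pred2 k l) (swap_args x k l) =
  swap_args (map_args f (pred2 k l) x) k l.
Proof.
apply/ffunP=> m; rewrite !ffunE !inE.
by case: tpermP => [->|->|/eqP/negPf-> /eqP/negPf->]; rewrite ?eqxx ?orbT.
Qed.

Lemma eq_map_args f (A B : {pred 'I_n}) x :
  A =i B -> map_args f A x = map_args f B x.
Proof. by move=> AB; apply/ffunP=> l; rewrite !ffunE AB. Qed.

End Arguments.

Section RconsArgs.

Variables (m : nat) (L : Type).
Implicit Types (x : {ffun 'I_m.+1 -> L}) (f : L -> L) (z : L).

(** The arity [m.+2] ensures that [x] is nonempty, so position [ord0] lies in [x], whereas [ord_max]
    is the slot of [z]. *)
Lemma map_rcons_args_first f x z :
  map_args f (pred1 (ord0 : 'I_m.+2)) (@rcons_args m.+2 L x z) =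
  @rcons_args m.+2 L (map_args f (pred1 ord0) x) z.
Proof.
apply/ffunP=> l; rewrite !ffunE inE.
case: insubP => [u _ ul|] /=; first by rewrite ffunE inE -!val_eqE /= ul.
by rewrite -val_eqE /=; case: (val l).
Qed.

Lemma map_rcons_args_last f x z :
  map_args f (pred1 (ord_max : 'I_m.+2)) (@rcons_args m.+2 L x z) =
  @rcons_args m.+2 L x (f z).
Proof.
apply/ffunP=> l; rewrite !ffunE inE -val_eqE /=.
case: insubP => [u lt_l _|] /=; first by rewrite ltn_eqF.
by rewrite -leqNgt => le_l; rewrite eqn_leq -ltnS ltn_ord le_l.
Qed.

Lemma map_rcons_args_ends f x z :
  map_args f (pred2 ord0 (ord_max : 'I_m.+2)) (@rcons_args m.+2 L x z) =
  @rcons_args m.+2 L (map_args f (pred1 ord0) x) (f z).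
Proof.
rewrite -map_rcons_args_last -map_rcons_args_first.
apply/ffunP=> l; rewrite !ffunE !inE.
by case: eqP => [->|_]; case: eqP.
Qed.

End RconsArgs.

Section Averaging.

Variables (K : fieldType) (G : zmodType) (L : lmodType K) (n : nat).
Variables (gr : G -> {pred L}) (br : {ffun 'I_n -> L} -> L).
Variables (alpha beta : {linear L -> L}).
Hypothesis Hbeta : averaging_operator gr br alpha beta.
Implicit Types (x : {ffun 'I_n -> L}) (p q r s : 'I_n).

Lemma homogeneous_map_args m (A : {pred 'I_m}) (a : 'I_m -> G)
    (x : {ffun 'I_m -> L}) :
  (forall k, x k \in gr (a k)) -> forall k, map_args beta A x k \in gr (a k).
Proof.
by move=> xa k; rewrite ffunE; case: ifP => _; rewrite ?(avg_even Hbeta).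
Qed.

Lemma averaging_pred1 p q x :
  beta (br (map_args beta (pred1 p) x)) = beta (br (map_args beta (pred1 q) x)).
Proof.
have [->//|npq] := eqVneq p q.
rewrite (avg_bracket Hbeta x npq) (@avg_bracket _ _ _ _ _ _ _ _ Hbeta q p);
  last by rewrite eq_sym.
by congr br; apply: eq_map_args => l; rewrite !inE orbC.
Qed.

Lemma averaging_pred2 p q r s x : p != q -> r != s ->
  br (map_args beta (pred2 p q) x) = br (map_args beta (pred2 r s) x).
Proof.
by move=> npq nrs; rewrite -!(avg_bracket Hbeta) // (averaging_pred1 p r).
Qed.

(** After one use of averaging on the left, the copies of [beta] at [r] and [k] form an admissible
    pair as soon as [r] differs from [k]. If [p] is [k], reversing the pair reduces to this case. *)
Lemma averaging_pred2_beta (k p q : 'I_n) x : p != q ->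
  br (map_args beta (pred2 p q) (map_args beta (pred1 k) x)) =
  beta (br (map_args beta (pred2 p q) x)).
Proof.
have main r s : r != s -> r != k ->
    br (map_args beta (pred2 r s) (map_args beta (pred1 k) x)) =
    beta (br (map_args beta (pred2 r s) x)).
  move=> nrs nrk; rewrite -(avg_bracket Hbeta) //; congr (beta _).
  rewrite (averaging_pred2 _ nrs nrk); congr br.
  apply/ffunP=> l; rewrite !ffunE !inE.
  by have [->|] := eqVneq l r; rewrite ?(negPf nrk).
move=> npq; have [pk|] := eqVneq p k; last exact: main.
have nqp : q != p by rewrite eq_sym.
by rewrite !(averaging_pred2 _ npq nqp) main // -pk.
Qed.

End Averaging.

Section NewBracket.

Variables (K : fieldType) (G : zmodType) (L : lmodType K) (n : nat).
Variables (gr : G -> {pred L}) (br : {ffun 'I_n -> L} -> L) (eps : G -> G -> K).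
Variables (alpha beta : {linear L -> L}).
Hypothesis Hbeta : averaging_operator gr br alpha beta.

Lemma multilinear_map_args (A : {pred 'I_n}) :
  multilinear br -> multilinear (fun x => br (map_args beta A x)).
Proof.
move=> br_lin x k c u v; rewrite !map_set_arg.
by case: ifP => _; rewrite ?linearP br_lin.
Qed.

Lemma averaging_color_skew (i j : 'I_n) : i != j -> color_skew gr br eps ->
  color_skew gr (fun x => br (map_args beta (pred2 i j) x)) eps.
Proof.
move=> nij br_skew a x xa k l lk.
have nkl : k != l by rewrite -val_eqE /= lk ltn_eqF.
rewrite !(averaging_pred2 Hbeta _ nij nkl) map_swap_args.
exact: br_skew (homogeneous_map_args Hbeta _ xa) _ _ lk.
Qed.

End NewBracket.

Lemma averaging_hom_Nambu (K : fieldType) (G : zmodType) (L : lmodType K)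
    (n : nat) (gr : G -> {pred L}) (br : {ffun 'I_n -> L} -> L)
    (eps : G -> G -> K) (alpha beta : {linear L -> L}) (p q : 'I_n) :
  averaging_operator gr br alpha beta -> p != q ->
  hom_Nambu gr br eps alpha ->
  hom_Nambu gr (fun x => br (map_args beta (pred2 p q) x)) eps alpha.
Proof.
(* Two distinct positions exist only for arity at least 2. *)
case: n br p q => [|[|m]] br p q; first by case: p.
  by rewrite !ord1.
move=> Hbeta npq br_Nambu a x b y xa yb.
have n0m : ord0 != ord_max :> 'I_m.+2 by [].
have ends z := averaging_pred2 Hbeta z npq n0m.
pose new z := br (map_args beta (pred2 p q) z).
pose x' := map_args beta (pred1 ord0) x.
pose y'' := map_args beta (pred2 p q) (map_args beta (pred1 q) y).
have newE z u : new (@rcons_args m.+2 L z u) =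
    br (@rcons_args m.+2 L (map_args beta (pred1 ord0) z) (beta u)).
  by rewrite /new ends map_rcons_args_ends.
have beta_arg k z : new (map_args beta (pred1 k) z) = beta (new z).
  exact: (averaging_pred2_beta Hbeta).
have beta_set k z u : new (set_arg z k (beta u)) = beta (new (set_arg z k u)).
  by rewrite -(beta_arg k) map_set_arg !inE eqxx set_arg_map1.
have x'a : forall k, x' k \in gr (a k) by exact: (homogeneous_map_args Hbeta).
have y''b : forall k, y'' k \in gr (b k).
  by do 2!apply: (homogeneous_map_args Hbeta).
have alphaC k (A : {pred 'I_k}) (z : {ffun 'I_k -> L}) :
    map_args beta A [ffun l => alpha (z l)] =
    [ffun l => alpha (map_args beta A z l)].
  by apply/ffunP=> l; rewrite !ffunE; case: ifP; rewrite ?(avg_comm Hbeta).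
(* The outer [beta] on the inner bracket is absorbed at position [q], which turns [y] into [y'']. *)
rewrite -![br (map_args _ (pred2 p q) _)]/(new _) newE alphaC -(beta_arg q).
rewrite [LHS](br_Nambu a x' b y'' x'a y''b); apply: eq_bigr => k _.
congr (_ *: _); rewrite -![br (map_args _ (pred2 p q) _)]/(new _).
pose w := br (@rcons_args m.+2 L x' (y k)).
have beta_w : beta w = new (@rcons_args m.+2 L x (y k)).
  by rewrite /w -map_rcons_args_first (avg_bracket Hbeta _ n0m) -ends.
(* The right side is now [beta (new (set_arg ay k w))]; what remains is where this outer [beta]
   goes. *)
rewrite -beta_w beta_set -[in LHS]alphaC -alphaC.
set ay := [ffun l => alpha (y l)].
(* For [k = q] it goes onto the inserted entry, so both sides carry [beta (beta w)] there; otherwise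
   it goes to position [q], and the inserted entry is [beta w] if [k = p] and [w] if not. *)
have [kq|nkq] := eqVneq k q.
  have -> : y'' k = beta (beta (y k)).
    by rewrite !ffunE !inE kq eqxx orbT.
  rewrite -newE -map_rcons_args_last beta_arg -beta_w -beta_set.
  by rewrite -(set_arg_map1 beta ay) /new map_set_arg !inE kq eqxx orbT.
rewrite -(beta_arg q) /new !map_set_arg !inE (negPf nkq) orbF.
congr (br (set_arg _ k _)); rewrite !ffunE !inE (negPf nkq) orbF.
by case: eqP => // _; rewrite beta_w newE.
Qed.

Theorem theorem3p19 (K : fieldType) (charK : 2%N \notin [pchar K])
    (G : zmodType) (L : lmodType K) (n : nat) (n_ge2 : (2 <= n)%N)
    (gr : G -> {pred L}) (br : {ffun 'I_n -> L} -> L) (eps : G -> G -> K)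
    (alpha beta : {linear L -> L})
    (HL : nHomLieColor gr br eps alpha)
    (Hbeta : averaging_operator gr br alpha beta)
    (i j : 'I_n) (lt_ij : (i < j)%N) :
  nHomLieColor gr (fun x => br (map_args beta (pred2 i j) x)) eps alpha.
Proof.
have nij : i != j by rewrite -val_eqE /= ltn_eqF.
case: HL => gr_grading br_lin eps_bichar alpha_even br_skew br_Nambu.
split=> //.
- exact: multilinear_map_args.
- exact: (averaging_color_skew Hbeta nij br_skew).
- exact: (averaging_hom_Nambu Hbeta nij br_Nambu).
Qed.
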